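(* Consider a finite POMDP with geometrically distributed horizon as in the context and let $\beta,\lambda\ge0$. If a deterministic policy $\mu^*\in\mathcal P$ minimizes $$E_T\big[J_\mu^T+\beta H_\mu(X^T\mid Y^T,U^{T-1})+\lambda H_\mu(Y^T\|U^{T-1})\big]$$ over all policies $\mu\in\mathcal P$, then $\mu^*$ also minimizes $$E_T\big[J_\mu^T+\beta H_\mu(X^T\mid Y^T,U^{T-1})+\lambda H_\mu(Y^T,U^{T-1})\big]$$ over all policies $\mu\in\mathcal P$ (with the same $\beta,\lambda$).
   Context: Logarithms are base 2, $0\log0=0$, empty sums are $0$ and empty products are $1$. Superscripts denote trajectories: $X^T=(X_0,\dots,X_T)$, and similarly for $Y^T$, $U^{T-1}$; $U^{-1}$ and $Y^{-1}$ are empty. POMDP: finite sets $\mathcal X=\{1,\dots,N_x\}$ (states), $\mathcal U=\{1,\dots,N_u\}$ (controls), $\mathcal Y=\{1,\dots,N_y\}$ (observations); initial pmf $\rho$ of $X_0$ on $\mathcal X$; transition kernel $A^{x,\bar x}(u)=p(X_{k+1}=x\mid X_k=\bar x,U_k=u)$; observation kernel $B^{x,y}(u)=p(Y_k=y\mid X_k=x,U_{k-1}=u)$ for $k>0$ and $B^{x_0,y_0}=p(Y_0=y_0\mid X_0=x_0)$. A policy is $\mu=\{\mu_k^{i_k}:k\ge0\}$, where for each $i_k=(y^k,u^{k-1})$, $\mu_k^{i_k}(u_k)=p(U_k=u_k\mid Y^k=y^k,U^{k-1}=u^{k-1})$ is a pmf on $\mathcal U$; the policy is deterministic if at all times $k\ge0$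 the support of $\mu_k^{i_k}$ is a single control, and stochastic otherwise. $\mathcal P$ is the set of all policies (stochastic or deterministic). Under $\mu$, $$p_\mu(x^T,y^T,u^{T-1})=\rho(x_0)B^{x_0,y_0}\prod_{k=0}^{T-1}A^{x_{k+1},x_k}(u_k)\,\mu_k^{i_k}(u_k)\,B^{x_{k+1},y_{k+1}}(u_k),$$ $E_\mu$ is expectation and $H_\mu$ is (conditional) Shannon entropy under this law. For a fixed horizon $T\ge0$: $J_\mu^T=E_\mu[c_T(X_T)+\sum_{k=0}^{T-1}c(X_k,U_k)]$ with arbitrary $c:\mathcal X\times\mathcal U\to\mathbb R$, $c_T:\mathcal X\to\mathbb R$; $H_\mu(X^T\mid Y^T,U^{T-1})=-E_\mu[\log p_\mu(X^T\mid Y^T,U^{T-1})]$; $H_\mu(Y^T,U^{T-1})=-E_\mu[\log p_\mu(Y^T,U^{T-1})]$; and the causally conditioned entropy is $H_\mu(Y^T\|U^{T-1})\triangleq\sum_{k=0}^TH_\mu(Y_k\mid Y^{k-1},U^{k-1})$, with the $k=0$ term equal to $H(Y_0)$. The horizon is geometric: for a parameter $0<\gamma<1$, $P(T=t)=\gamma^t(1-\gamma)$, $t\ge0$, so $E_T[F(T)]=\sum_{t\ge0}(1-\gamma)\gamma^tF(t)$. *)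

(* Defs.v *)
From mathcomp Require Import all_boot all_order all_algebra.
From mathcomp Require Import boolp classical_sets reals ereal.
From mathcomp Require Import topology normedtype sequences exp.

Set Implicit Arguments.
Unset Strict Implicit.
Unset Printing Implicit Defensive.

Import Order.TTheory GRing.Theory Num.Theory.
Local Open Scope ring_scope.

Definition is_pmf (R : realType) (S : finType) (f : S -> R) : Prop :=
  (forall s, 0 <= f s) /\ \sum_s f s = 1.

(* [ln] is total with [ln 0 = 0], and below logarithms only occur multiplied by
   the probability of the outcome, so that 0 log 0 = 0. *)
Definition log2 (R : realType) (x : R) : R := ln x / ln 2.

Section FiniteProbability.
Variables (R : realType) (Omega : finType) (P : Omega -> R).

Definition expect (f : Omega -> R) : R := \sum_w P w * f w.

Definition prob (S : eqType) (V : Omega -> S) (s : S) : R :=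
  \sum_(w | V w == s) P w.

Definition cprob (S S' : eqType) (V : Omega -> S) (W : Omega -> S')
    (s : S) (s' : S') : R :=
  prob (fun w => (V w, W w)) (s, s') / prob W s'.

Definition entropy (S : eqType) (V : Omega -> S) : R :=
  - expect (fun w => log2 (prob V (V w))).

Definition cond_entropy (S S' : eqType) (V : Omega -> S) (W : Omega -> S') : R :=
  - expect (fun w => log2 (cprob V W (V w) (W w))).

End FiniteProbability.

(* [trans M u x xb] = p(X_{k+1} = x | X_k = xb, U_k = u),
   [obs M u x y] = p(Y_k = y | X_k = x, U_{k-1} = u) for k > 0, and
   [obs0 M x y] = p(Y_0 = y | X_0 = x). *)
Record pomdp (R : realType) (Nx Nu Ny : nat) := Pomdp {
  rho : 'I_Nx -> R;
  trans : 'I_Nu -> 'I_Nx -> 'I_Nx -> R;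
  obs0 : 'I_Nx -> 'I_Ny -> R;
  obs : 'I_Nu -> 'I_Nx -> 'I_Ny -> R;
  rho_pmf : is_pmf rho;
  trans_pmf : forall u xb, is_pmf (fun x => trans u x xb);
  obs0_pmf : forall x, is_pmf (obs0 x);
  obs_pmf : forall u x, is_pmf (obs u x)
}.

(* At time k the information state is (y^k, u^{k-1}), of lengths k+1 and k. *)
Record policy (R : realType) (Nu Ny : nat) := Policy {
  pol : forall k : nat, k.+1.-tuple 'I_Ny -> k.-tuple 'I_Nu -> 'I_Nu -> R;
  pol_pmf : forall k yk uk, is_pmf (@pol k yk uk)
}.

Definition deterministic (R : realType) (Nu Ny : nat) (mu : policy R Nu Ny) :
    Prop :=
  forall (k : nat) (yk : k.+1.-tuple 'I_Ny) (uk : k.-tuple 'I_Nu),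
  exists u, forall v, (pol mu yk uk v != 0) = (v == u).

Definition initial (S : Type) (m n : nat) (le_mn : (m <= n)%N)
    (s : n.-tuple S) : m.-tuple S :=
  [tuple tnth s (widen_ord le_mn i) | i < m].

(* Trajectories (x^T, y^T, u^{T-1}). *)
Definition traj (Nx Nu Ny T : nat) : finType :=
  (T.+1.-tuple 'I_Nx * T.+1.-tuple 'I_Ny * T.-tuple 'I_Nu)%type.

Section Trajectories.
Variables (Nx Nu Ny T : nat).
Implicit Types w : traj Nx Nu Ny T.

Definition xT w : T.+1.-tuple 'I_Nx := w.1.1.
Definition yT w : T.+1.-tuple 'I_Ny := w.1.2.
Definition uT w : T.-tuple 'I_Nu := w.2.

Definition now (k : 'I_T) : 'I_T.+1 := widen_ord (leqnSn T) k.
Definition next (k : 'I_T) : 'I_T.+1 := lift ord0 k.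

End Trajectories.

Section Law.
Variables (R : realType) (Nx Nu Ny : nat).
Variables (M : pomdp R Nx Nu Ny) (mu : policy R Nu Ny) (T : nat).

Definition law (w : traj Nx Nu Ny T) : R :=
  rho M (tnth (xT w) ord0) * obs0 M (tnth (xT w) ord0) (tnth (yT w) ord0) *
  \prod_(k < T)
    (trans M (tnth (uT w) k) (tnth (xT w) (next k)) (tnth (xT w) (now k)) *
     pol mu (initial (leqW (ltn_ord k)) (yT w))
            (initial (ltnW (ltn_ord k)) (uT w)) (tnth (uT w) k) *
     obs M (tnth (uT w) k) (tnth (xT w) (next k)) (tnth (yT w) (next k))).

Definition cost (c : 'I_Nx -> 'I_Nu -> R) (cT : 'I_Nx -> R) : R :=
  expect law (fun w =>
    cT (tnth (xT w) ord_max) +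
    \sum_(k < T) c (tnth (xT w) (now k)) (tnth (uT w) k)).

(* H(X^T | Y^T, U^{T-1}) *)
Definition smoother_entropy : R :=
  cond_entropy law (@xT Nx Nu Ny T) (fun w => (yT w, uT w)).

(* H(Y^T, U^{T-1}) *)
Definition io_entropy : R := entropy law (fun w => (yT w, uT w)).

(* H(Y^T || U^{T-1}); at k = 0 the conditioning variables are empty tuples,
   hence that term is H(Y_0). *)
Definition causal_entropy : R :=
  \sum_(k < T.+1)
    cond_entropy law (fun w => tnth (yT w) k)
      (fun w => (initial (ltnW (ltn_ord k)) (yT w),
                 initial (ltn_ord k : (k <= T)%N) (uT w))).

End Law.

(* E_T[F(T)] for P(T = t) = (1 - gamma) gamma^t. The series is taken in the
   extended reals. *)
Definition geom_expect (R : realType) (gamma : R) (F : nat -> R) : \bar R :=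
  (\sum_(0 <= t <oo) ((1 - gamma) * gamma ^+ t * F t)%:E)%E.

Section Objectives.
Variables (R : realType) (Nx Nu Ny : nat) (M : pomdp R Nx Nu Ny).
Variables (c : 'I_Nx -> 'I_Nu -> R) (cT : nat -> 'I_Nx -> R).
Variables (gamma beta lambda : R).

(* The terminal cost [cT T] is allowed to depend on the horizon T. *)
Definition causal_objective (mu : policy R Nu Ny) : \bar R :=
  geom_expect gamma (fun T =>
    cost M mu T c (cT T) + beta * smoother_entropy M mu T
    + lambda * causal_entropy M mu T).

Definition joint_objective (mu : policy R Nu Ny) : \bar R :=
  geom_expect gamma (fun T =>
    cost M mu T c (cT T) + beta * smoother_entropy M mu T
    + lambda * io_entropy M mu T).

End Objectives.

Definition minimizes (R : realType) (Nu Ny : nat)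
    (J : policy R Nu Ny -> \bar R) (mu : policy R Nu Ny) : Prop :=
  forall nu : policy R Nu Ny, (J mu <= J nu)%E.

(* Main.v *)
(** The chain rule gives
      H(Y^T, U^{T-1}) = H(Y^T || U^{T-1}) + sum_{k<T} H(U_k | Y^k, U^{k-1}).
    The last sum is nonnegative and vanishes for a deterministic policy, so
    the joint objective dominates the causal one, with equality at [mu].  The
    sum grows at most linearly in T, so its expectation over the geometric
    horizon is finite: adding it affects neither the existence of the limit
    defining [geom_expect], nor the comparison when that limit is infinite. *)
Require Import Defs.
From mathcomp Require Import all_boot all_order all_algebra.
From mathcomp Require Import ring lra zify.
From mathcomp Require Import boolp classical_sets reals ereal.
From mathcomp Require Import topology normedtype sequences exp.

Import Order.TTheory GRing.Theory Num.Theory.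
Import numFieldNormedType.Exports.
Local Open Scope ring_scope.

(** * Entropy of random variables on a finite space with weights [P] *)

Section Entropy.
Set Implicit Arguments.
Unset Strict Implicit.
Variables (R : realType) (Omega : finType) (P : Omega -> R).
Hypothesis P_ge0 : forall w, 0 <= P w.

Lemma prob_ge (S : eqType) (V : Omega -> S) w : P w <= prob P V (V w).
Proof.
by rewrite /prob (bigD1 w) //= lerDl; apply: sumr_ge0 => *; exact: P_ge0.
Qed.

Lemma prob_gt0 (S : eqType) (V : Omega -> S) w :
  P w != 0 -> 0 < prob P V (V w).
Proof.
move=> Pw; apply: lt_le_trans (prob_ge V w).
by rewrite lt_neqAle eq_sym Pw P_ge0.
Qed.

Lemma ln2_gt0 : 0 < ln (2 : R).
Proof. by rewrite ln_gt0// ltr1n. Qed.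

Lemma log2_div (x y : R) : 0 < x -> 0 < y -> log2 (x / y) = log2 x - log2 y.
Proof. by move=> x0 y0; rewrite /log2 ln_div ?posrE// mulrBl. Qed.

Lemma cond_entropyE (S S' : eqType) (V : Omega -> S) (W : Omega -> S') :
  cond_entropy P V W = entropy P (fun w => (V w, W w)) - entropy P W.
Proof.
rewrite /cond_entropy /entropy /expect opprK addrC -opprB; congr (- _).
rewrite -sumrB; apply: eq_bigr => w _.
have [->|Pw] := eqVneq (P w) 0; first by rewrite !mul0r subrr.
by rewrite /cprob log2_div ?prob_gt0// ?mulrBr// (prob_gt0 (fun w => (V w, W w))).
Qed.

(** Entropy depends only on the partition that a variable induces on the support of [P]. This lets
    variables be re-encoded, and lets a component determined by the others almost surely be
    dropped. *)
Lemma eq_entropy (S S' : eqType) (V : Omega -> S) (W : Omega -> S') :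
  (forall w w', P w != 0 -> P w' != 0 -> (V w == V w') = (W w == W w')) ->
  entropy P V = entropy P W.
Proof.
move=> VW; rewrite /entropy; congr (- _); apply: eq_bigr => w _.
have [->|Pw] := eqVneq (P w) 0; first by rewrite !mul0r.
congr (_ * log2 _); rewrite /prob big_mkcond [RHS]big_mkcond /=.
apply: eq_bigr => w' _.
have [->|Pw'] := eqVneq (P w') 0; first by rewrite !if_same.
by rewrite VW.
Qed.

Lemma cprob_le1 (S S' : eqType) (V : Omega -> S) (W : Omega -> S') w :
  P w != 0 -> cprob P V W (V w) (W w) <= 1.
Proof.
move=> Pw; rewrite /cprob ler_pdivrMr ?prob_gt0// mul1r /prob.
rewrite big_mkcond [leRHS]big_mkcond /=; apply: ler_sum => w' _.
by rewrite xpair_eqE; case: eqP => //= _; case: eqP => //=; rewrite P_ge0.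
Qed.

Lemma cond_entropy_ge0 (S S' : eqType) (V : Omega -> S) (W : Omega -> S') :
  0 <= cond_entropy P V W.
Proof.
rewrite /cond_entropy oppr_ge0; apply: sumr_le0 => w _.
have [->|Pw] := eqVneq (P w) 0; first by rewrite mul0r.
rewrite mulr_ge0_le0// /log2 mulr_le0_ge0//; last by rewrite invr_ge0 ltW// ln2_gt0.
by rewrite ln_le0// cprob_le1.
Qed.

Lemma sum_prob (S : finType) (V : Omega -> S) : \sum_s prob P V s = \sum_w P w.
Proof. by rewrite [RHS](partition_big V predT). Qed.

Lemma expect_comp (S : finType) (V : Omega -> S) (F : S -> R) :
  expect P (fun w => F (V w)) = expect (prob P V) F.
Proof.
rewrite /expect (partition_big V predT)//=; apply: eq_bigr => s _.
by rewrite /prob mulr_suml; apply: eq_bigr => w /eqP ->.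
Qed.

(* [- ln q <= 1 / q], and the expectation of [1 / q] is at most the number of
   values of [V].  The sharp bound [log2 #|S|] is not needed. *)
Lemma cond_entropy_le (S S' : finType) (V : Omega -> S) (W : Omega -> S') :
  cond_entropy P V W <= #|S|%:R * (\sum_w P w) / ln 2.
Proof.
pose VW w := (V w, W w).
pose F (s : S * S') := prob P W s.2 / prob P VW s.
have W_ge0 s : 0 <= prob P W s by apply: sumr_ge0.
apply: (@le_trans _ _ (expect P (fun w => F (VW w)) / ln 2)).
  rewrite /cond_entropy /expect mulr_suml -sumrN; apply: ler_sum => w _.
  have [->|Pw] := eqVneq (P w) 0; first by rewrite !mul0r oppr0.
  rewrite /log2 mulrA -mulNr ler_wpM2r ?invr_ge0 ?(ltW ln2_gt0)//.
  rewrite -mulrN ler_wpM2l//.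
  have W0 := prob_gt0 W Pw; have VW0 := prob_gt0 VW Pw.
  rewrite /cprob -lnV ?posrE ?divr_gt0// invf_div.
  by rewrite ltW// ln_sublinear// divr_gt0.
rewrite ler_wpM2r ?invr_ge0 ?(ltW ln2_gt0)//.
rewrite (expect_comp VW F) -(sum_prob W) mulr_sumr.
apply: (@le_trans _ _ (\sum_(s : S * S') prob P W s.2)).
  apply: ler_sum => s _; rewrite /F.
  (* Pairs of probability zero contribute 0 on the left, which is why this is only an inequality. *)
  have [->|q0] := eqVneq (prob P VW s) 0; first by rewrite mul0r.
  by rewrite mulrC divfK.
rewrite (eq_bigr (fun s => (fun _ s' => prob P W s') s.1 s.2))//.
rewrite -(pair_bigA _ (fun _ s' => prob P W s'))/= exchange_big/=.
by apply: ler_sum => s _; rewrite sumr_const mulr_natl.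
Qed.

Lemma entropy_const (S : eqType) (V : Omega -> S) :
  \sum_w P w = 1 -> (forall w w', V w = V w') -> entropy P V = 0.
Proof.
move=> P1 Vc; rewrite /entropy /expect big1 ?oppr0// => w _.
rewrite /prob (eq_bigl predT) => [|w']; last by rewrite (Vc w' w) eqxx.
by rewrite P1 /log2 ln1 mul0r mulr0.
Qed.

End Entropy.

(** * Prefixes of tuples *)

Section Initial.
Set Implicit Arguments.
Unset Strict Implicit.
Variables (S : Type) (n : nat).
Implicit Types (s : n.-tuple S) (a : S).

Lemma val_initial m (le_mn : (m <= n)%N) s : val (initial le_mn s) = take m s.
Proof.
have szm : size (take m s) = m by rewrite size_takel ?size_tuple.
(* The case [m = 0] is separate because [nth] needs a default element, and [S] may be empty; for
   [m > 0] the tuple [s] supplies one. *)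
case: m le_mn szm => [|m] le_mn szm.
  by rewrite take0; apply: size0nil; rewrite size_tuple.
have x0 : S := tnth s (Ordinal le_mn).
apply: (@eq_from_nth _ x0) => [|i]; rewrite size_tuple ?szm// => im.
by rewrite -(tnth_nth x0 _ (Ordinal im)) tnth_mktuple (tnth_nth x0) /= nth_take.
Qed.

Lemma tnth_rcons_tuple s a (i : 'I_n.+1) (j : 'I_n) :
  i = j :> nat -> tnth (rcons_tuple s a) i = tnth s j.
Proof.
by move=> ij; rewrite !(tnth_nth a) /= nth_rcons size_tuple ij ltn_ord.
Qed.

Lemma tnth_rcons_tuple_last s a (i : 'I_n.+1) :
  i = n :> nat -> tnth (rcons_tuple s a) i = a.
Proof. by move=> i_n; rewrite (tnth_nth a) /= nth_rcons size_tuple i_n ltnn eqxx. Qed.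

Lemma initial_rcons m (le_mn : (m <= n)%N) (le_mn1 : (m <= n.+1)%N) s a :
  initial le_mn1 (rcons_tuple s a) = initial le_mn s.
Proof.
apply: eq_from_tnth => i; rewrite !tnth_mktuple.
exact: tnth_rcons_tuple.
Qed.

Lemma initial_rcons_id (le_n : (n <= n.+1)%N) s a :
  initial le_n (rcons_tuple s a) = s.
Proof. by apply: eq_from_tnth => i; rewrite tnth_mktuple; exact: tnth_rcons_tuple. Qed.

End Initial.

Section TupleEq.
Set Implicit Arguments.
Unset Strict Implicit.
Variables (S : eqType) (n : nat).
Implicit Types s t : n.-tuple S.

Lemma initial_eq m (le_mn : (m <= n)%N) s t :
  (initial le_mn s == initial le_mn t) = (take m s == take m t).
Proof. by rewrite -(inj_eq val_inj) !val_initial. Qed.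

Lemma take_tnth_eq s t (k : 'I_n) :
  (take k.+1 s == take k.+1 t) = (tnth s k == tnth t k) && (take k s == take k t).
Proof.
have x0 := tnth s k.
rewrite !(take_nth x0) ?size_tuple// !(tnth_nth x0).
by rewrite eqseq_rcons andbC.
Qed.

End TupleEq.

(** * The law of trajectories and its total mass *)

Section TrajectoryLaw.
Set Implicit Arguments.
Unset Strict Implicit.
Variables (R : realType) (Nx Nu Ny : nat).
Variables (M : pomdp R Nx Nu Ny) (mu : policy R Nu Ny).

Lemma law_ge0 T (w : traj Nx Nu Ny T) : 0 <= law M mu w.
Proof.
rewrite /law !mulr_ge0//; first exact: (rho_pmf M).1.
  exact: (obs0_pmf M _).1.
apply: prodr_ge0 => k _; rewrite !mulr_ge0//.
- exact: (trans_pmf M _ _).1.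
- exact: (pol_pmf mu _ _).1.
- exact: (obs_pmf M _ _).1.
Qed.

Definition extend T (p : traj Nx Nu Ny T * ('I_Nu * ('I_Nx * 'I_Ny))) :
    traj Nx Nu Ny T.+1 :=
  let: ((x, y, u), (v, (a, b))) := p in
  (rcons_tuple x a, rcons_tuple y b, rcons_tuple u v).

(** Injectivity is enough because both types have the same cardinality. *)
Lemma extend_bij T : bijective (@extend T).
Proof.
apply: inj_card_bij.
  move=> [[[x y] u] [v [a b]]] [[[x' y'] u'] [v' [a' b']]] [].
  by do 3![move=> /rcons_inj[/val_inj -> ->]].
by rewrite !card_prod !card_tuple !card_ord !(expnS _ T.+1) !(expnS _ T); nia.
Qed.

(** The factors before the last one only read prefixes, which appending entries leaves unchanged;
    hence only the last factor of the product is new. *)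
Lemma law_extend T (w : traj Nx Nu Ny T) v a b :
  law M mu (extend (w, (v, (a, b)))) =
  law M mu w *
  (trans M v a (tnth (xT w) ord_max) * pol mu (yT w) (uT w) v * obs M v a b).
Proof.
case: w => [[x y] u]; rewrite /law /xT /yT /uT /= big_ord_recr /= !mulrA.
congr (_ * _ * _ * _).
- congr (_ * _ * _).
  + by congr rho; exact: tnth_rcons_tuple.
  + by congr obs0; exact: tnth_rcons_tuple.
  apply: eq_bigr => k _; congr (_ * _ * _).
  + by congr trans; exact: tnth_rcons_tuple.
  + by congr pol; by [exact: initial_rcons | exact: tnth_rcons_tuple].
  + by congr obs; exact: tnth_rcons_tuple.
- by congr trans; by [exact: tnth_rcons_tuple_last | exact: tnth_rcons_tuple].
- by congr pol; by [exact: initial_rcons_id | exact: tnth_rcons_tuple_last].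
- by congr obs; exact: tnth_rcons_tuple_last.
Qed.

(** Induction on the horizon: the last observation, the last state and the last control are summed
    out in this order, each kernel having mass 1. *)
Lemma sum_law T : \sum_w law M mu (w : traj Nx Nu Ny T) = 1.
Proof.
elim: T => [|T IH].
  pose h (p : 'I_Nx * 'I_Ny) : traj Nx Nu Ny 0 :=
    ([tuple p.1], [tuple p.2], [tuple]).
  have h_bij : bijective h.
    apply: inj_card_bij; first by move=> [a b] [a' b'] [-> ->].
    by rewrite !card_prod !card_tuple !card_ord !expn1 expn0 muln1.
  rewrite (reindex h) /=; last exact: onW_bij.
  rewrite (eq_bigr (fun p => rho M p.1 * obs0 M p.1 p.2)); last first.
    by move=> [a b] _; rewrite /law big_ord0 mulr1.
  rewrite -(pair_bigA _ (fun a b => rho M a * obs0 M a b)) /=.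
  rewrite -[RHS](rho_pmf M).2; apply: eq_bigr => a _.
  by rewrite -mulr_sumr (obs0_pmf M a).2 mulr1.
rewrite (reindex (@extend T)) /=; last exact/onW_bij/extend_bij.
rewrite -[RHS]IH.
rewrite (eq_bigr (fun p => (fun w q => law M mu (extend (w, q))) p.1 p.2)); last by case.
rewrite -(pair_bigA _ (fun w q => law M mu (extend (w, q)))) /=.
apply: eq_bigr => w _.
(* The factors are reordered so that each one depends only on variables summed at its own level or
   further out. *)
rewrite (eq_bigr (fun q => law M mu w * (pol mu (yT w) (uT w) q.1 *
   (trans M q.1 q.2.1 (tnth (xT w) ord_max) * obs M q.1 q.2.1 q.2.2)))); last first.
  by move=> [v [a b]] _; rewrite law_extend /=; congr (_ * _); ring.
rewrite -mulr_sumr -[RHS]mulr1; congr (_ * _).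
rewrite -(pair_bigA _ (fun v q => pol mu (yT w) (uT w) v *
   (trans M v q.1 (tnth (xT w) ord_max) * obs M v q.1 q.2))) /=.
rewrite -[RHS](pol_pmf mu (yT w) (uT w)).2; apply: eq_bigr => v _.
rewrite -mulr_sumr -[RHS]mulr1; congr (_ * _).
rewrite -(pair_bigA _ (fun a b => trans M v a (tnth (xT w) ord_max) * obs M v a b)) /=.
rewrite -[RHS](trans_pmf M v (tnth (xT w) ord_max)).2; apply: eq_bigr => a _.
by rewrite -mulr_sumr (obs_pmf M v a).2 mulr1.
Qed.

(** * Chain rule and the entropy of the controls *)

Section Control.
Variable T : nat.
Let P := @law R Nx Nu Ny M mu T.
Let P_ge0 : forall w, 0 <= P w := @law_ge0 T.

(** Prefixes are plain sequences, not tuples, so that their type does not depend on the lengths and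
    entropies at successive times can telescope. *)
Definition io_prefix (m n : nat) (w : traj Nx Nu Ny T) :=
  (take m (yT w), take n (uT w)).

(** The information state $i_k=(y^k,u^{k-1})$, in exactly the form that [law] passes to [pol]. *)
Definition info (k : 'I_T) (w : traj Nx Nu Ny T) :=
  (initial (leqW (ltn_ord k)) (yT w), initial (ltnW (ltn_ord k)) (uT w)).

Lemma io_prefix_eq m n w w' : (io_prefix m n w == io_prefix m n w') =
  (take m (yT w) == take m (yT w')) && (take n (uT w) == take n (uT w')).
Proof. by rewrite xpair_eqE. Qed.

Lemma info_eq k w w' :
  (info k w == info k w') = (io_prefix k.+1 k w == io_prefix k.+1 k w').
Proof. by rewrite xpair_eqE !initial_eq io_prefix_eq. Qed.

Lemma causal_entropyE :
  causal_entropy M mu T =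
  \sum_(k < T.+1) (entropy P (io_prefix k.+1 k) - entropy P (io_prefix k k)).
Proof.
apply: eq_bigr => k _; rewrite cond_entropyE//; congr (_ - _).
  apply: eq_entropy => w w' _ _.
  by rewrite io_prefix_eq !xpair_eqE !initial_eq take_tnth_eq andbA.
by apply: eq_entropy => w w' _ _; rewrite io_prefix_eq !xpair_eqE !initial_eq.
Qed.

Lemma control_entropyE (k : 'I_T) :
  cond_entropy P (fun w => tnth (uT w) k) (info k) =
  entropy P (io_prefix k.+1 k.+1) - entropy P (io_prefix k.+1 k).
Proof.
rewrite cond_entropyE//; congr (_ - _).
  apply: eq_entropy => w w' _ _.
  rewrite [LHS]xpair_eqE info_eq !io_prefix_eq [take k.+1 (uT w) == _]take_tnth_eq.
  by rewrite andbCA.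
by apply: eq_entropy => w w' _ _; exact: info_eq.
Qed.

Definition control_entropy : R :=
  \sum_(k < T) cond_entropy P (fun w => tnth (uT w) k) (info k).

(** Both sums consist of increments of the entropy of [io_prefix] along the lengths (0,0), (1,0),
    (1,1), (2,1), and so on up to (T+1,T), so together they telescope. *)
Lemma io_entropyE : io_entropy M mu T = causal_entropy M mu T + control_entropy.
Proof.
rewrite causal_entropyE /control_entropy (eq_bigr _ (fun k _ => control_entropyE k)).
have -> : io_entropy M mu T = entropy P (io_prefix T.+1 T).
  apply: eq_entropy => w w' _ _.
  by rewrite io_prefix_eq !take_oversize ?size_tuple.
(* Splitting off the terms at lengths (0,0) and (T+1,T) aligns the remaining sums, which cancel in
   pairs; the empty prefix is constant and has entropy 0. *)
rewrite !sumrB [in X in _ - X + _]big_ord_recl [in X in X - _ + _]big_ord_recr /=.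
rewrite [entropy P (io_prefix 0 0)]entropy_const ?sum_law//; last first.
  by move=> w w'; rewrite /io_prefix !take0.
rewrite add0r; lra.
Qed.

Lemma control_entropy_ge0 : 0 <= control_entropy.
Proof. by apply: sumr_ge0 => k _; exact: cond_entropy_ge0. Qed.

Lemma control_entropy_le : control_entropy <= Nu%:R / ln 2 * T%:R.
Proof.
rewrite mulr_natr -[X in _ *+ X]card_ord -sumr_const; apply: ler_sum => k _.
by apply: le_trans (cond_entropy_le P_ge0 _ _) _; rewrite card_ord sum_law mulr1.
Qed.

(** On the support of the law, [info k] already determines the control at time [k], so adjoining
    that control does not refine the partition. *)
Lemma control_entropy_deterministic : deterministic mu -> control_entropy = 0.
Proof.
move=> mu_det; apply: big1 => k _; rewrite cond_entropyE//; apply/eqP.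
rewrite subr_eq0; apply/eqP/eq_entropy => // w w' Pw Pw'.
rewrite [LHS]xpair_eqE andb_idl// => /eqP eq_info.
(* A trajectory of nonzero probability has a nonzero policy factor at time [k]. *)
have pol_neq0 v : P v != 0 ->
    pol mu (info k v).1 (info k v).2 (tnth (uT v) k) != 0.
  rewrite /P /law mulf_eq0 negb_or => /andP[_].
  rewrite (bigD1 k)//= !mulf_eq0 !negb_or => /andP[/andP[/andP[_ +]]] _ _.
  exact.
move: (pol_neq0 _ Pw) (pol_neq0 _ Pw'); rewrite eq_info.
have [u uP] := mu_det _ (info k w').1 (info k w').2.
by rewrite !uP => /eqP -> /eqP ->.
Qed.

End Control.

End TrajectoryLaw.

(** * Expectation over the geometric horizon *)

Section Geometric.
Set Implicit Arguments.
Unset Strict Implicit.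
Variables (R : realType) (gamma : R).
Hypotheses (gamma_gt0 : 0 < gamma) (gamma_lt1 : gamma < 1).

(** Partial sums for the mean of the geometric law, cleared of denominators. The subtracted term is
    nonnegative, so [gamma] is a bound uniform in [n]. *)
Lemma sum_arith_geom n :
  (1 - gamma) ^+ 2 * (\sum_(0 <= t < n) t%:R * gamma ^+ t) =
  gamma - (n%:R * (1 - gamma) + gamma) * gamma ^+ n.
Proof.
elim: n => [|n IH]; first by rewrite big_nil expr0; ring.
by rewrite big_nat_recr//= mulrDr IH (exprS gamma) -natr1; ring.
Qed.

Lemma geom_expectE (F : nat -> R) : geom_expect gamma F =
  limn (fun n => (\sum_(0 <= t < n) (1 - gamma) * gamma ^+ t * F t)%:E).
Proof.
rewrite /geom_expect; congr (limn _); apply/funext => n.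
by rewrite sumEFin.
Qed.

(* If the series of [F] has no limit in [\bar R], neither has that of [F + G],
   and both expectations are the same default value. *)
Lemma le_geom_expect (F G : nat -> R) (K : R) :
  (forall t, 0 <= G t <= K * t%:R) ->
  (geom_expect gamma F <= geom_expect gamma (fun t => F t + G t)%R)%E.
Proof.
move=> G_bnd.
pose S (H : nat -> R) n : R := \sum_(0 <= t < n) (1 - gamma) * gamma ^+ t * H t.
have g1 : 0 < 1 - gamma by rewrite subr_gt0.
have K0 : 0 <= K.
  by have /andP[G0 /(le_trans G0)] := G_bnd 1%N; rewrite mulr1.
have weight_ge0 t : 0 <= (1 - gamma) * gamma ^+ t.
  by rewrite mulr_ge0 ?exprn_ge0// ltW.
have SG_nd : nondecreasing_seq (S G).
  apply/nondecreasing_seqP => n; rewrite /S big_nat_recr//= lerDl mulr_ge0//.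
  by have /andP[] := G_bnd n.
(* The bound is [K] times the mean [gamma / (1 - gamma)] of the horizon. *)
have SG_le n : S G n <= K * gamma / (1 - gamma).
  rewrite ler_pdivlMr//.
  apply: (@le_trans _ _
      (K * ((1 - gamma) ^+ 2 * \sum_(0 <= t < n) t%:R * gamma ^+ t))).
    rewrite /S mulr_suml !mulr_sumr; apply: ler_sum => t _.
    have /andP[_ Gt] := G_bnd t.
    have -> : K * ((1 - gamma) ^+ 2 * (t%:R * gamma ^+ t)) =
        (1 - gamma) * gamma ^+ t * (K * t%:R) * (1 - gamma) by ring.
    by rewrite ler_wpM2r ?ler_wpM2l// ltW.
  rewrite sum_arith_geom ler_wpM2l// lerBlDr lerDl.
  by rewrite mulr_ge0 ?exprn_ge0 ?addr_ge0 ?mulr_ge0// ltW.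
have SG_cvg : cvgn (S G).
  by apply: nondecreasing_is_cvgn => //; exists (K * gamma / (1 - gamma)) => _ [n _ <-].
have l_ge0 : 0 <= limn (S G).
  apply: limr_ge => //; near=> n; apply: sumr_ge0 => t _; rewrite mulr_ge0//.
  by have /andP[] := G_bnd t.
have SGE : ((S G n)%:E @[n --> \oo] --> (limn (S G))%:E)%classic.
  by apply: cvg_EFin => //; near=> n.
have SD : (fun n => (S (fun t => F t + G t) n)%:E) = (fun n => (S F n)%:E + (S G n)%:E)%E.
  apply/funext => n; rewrite -EFinD /S -big_split/=; congr (_%:E).
  by apply: eq_bigr => t _; rewrite mulrDr.
rewrite !geom_expectE -[X in (limn X <= _)%E]/(fun n => (S F n)%:E).
rewrite -[X in (_ <= limn X)%E]/(fun n => (S (fun t => F t + G t) n)%:E) SD.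
(* Convergence is meant in [\bar R], so the limit of [S F] may be infinite; adding the finite limit
   of [S G] is still well defined. *)
have [Fcvg|Fdvg] := pselect (cvgn (fun n => (S F n)%:E)).
  have -> : limn (fun n => (S F n)%:E + (S G n)%:E)%E =
      (limn (fun n => (S F n)%:E) + (limn (S G))%:E)%E.
    apply/cvg_lim => //; apply: cvgeD => //.
    by rewrite fin_num_adde_defl.
  by rewrite leeDl// lee_fin.
(* Otherwise subtracting the convergent real sequence [S G] would make [S F] converge. *)
have FGdvg : ~ cvgn (fun n => (S F n)%:E + (S G n)%:E)%E.
  move=> FGcvg; apply: Fdvg; apply/cvg_ex.
  exists (limn (fun n => (S F n)%:E + (S G n)%:E) - (limn (S G))%:E)%E.
  have -> : (fun n => (S F n)%:E) =
      (fun n => ((S F n)%:E + (S G n)%:E) - (S G n)%:E)%E.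
    by apply/funext => n; rewrite addeK.
  by apply: cvgeB => //; rewrite fin_num_adde_defl.
by rewrite (dvgP Fdvg) (dvgP FGdvg).
Unshelve. all: by end_near.
Qed.

End Geometric.

Theorem mainTheorem5 (R : realType) (Nx Nu Ny : nat) (M : pomdp R Nx Nu Ny)
    (c : 'I_Nx -> 'I_Nu -> R) (cT : nat -> 'I_Nx -> R)
    (gamma beta lambda : R)
    (gamma_gt0 : 0 < gamma) (gamma_lt1 : gamma < 1)
    (beta_ge0 : 0 <= beta) (lambda_ge0 : 0 <= lambda)
    (mu : policy R Nu Ny) (mu_det : deterministic mu)
    (mu_min : minimizes (causal_objective M c cT gamma beta lambda) mu) :
  minimizes (joint_objective M c cT gamma beta lambda) mu.
Proof.
have jointE nu : joint_objective M c cT gamma beta lambda nu =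
    geom_expect gamma (fun T =>
      cost M nu T c (cT T) + beta * smoother_entropy M nu T
      + lambda * causal_entropy M nu T + lambda * control_entropy M nu T).
  rewrite /joint_objective; congr geom_expect; apply/funext => T.
  by rewrite io_entropyE mulrDr addrA.
move=> nu.
have -> : joint_objective M c cT gamma beta lambda mu =
    causal_objective M c cT gamma beta lambda mu.
  rewrite jointE /causal_objective; congr geom_expect; apply/funext => T.
  by rewrite control_entropy_deterministic// mulr0 addr0.
apply: le_trans (mu_min nu) _; rewrite jointE.
(* The slope is [lambda] times the one in [control_entropy_le]. *)
apply: (@le_geom_expect _ _ gamma_gt0 gamma_lt1 _ _ (lambda * (Nu%:R / ln 2))) => T.
by rewrite mulr_ge0 ?control_entropy_ge0//= -mulrA ler_wpM2l// control_entropy_le.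
Qed.
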